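(* Let $M$ be a linear operator on $\mathbb{C}^n$ with associated multidiagram $\mathcal{Y}$, and let $H$ be a Hessenberg space with corresponding function $h$. There is a bijective correspondence between the nonempty affine cells $B\pi B\cap\mathcal{H}(M,H)$ of $\mathcal{H}(M,H)$ and the fillings of $\mathcal{Y}$ (box $i$ filled with $\pi^{-1}(i)$, for $\pi\in S_n$) such that whenever box $i$ lies directly above box $j$ (in the same Young diagram) one has $\pi^{-1}(j)\le h(\pi^{-1}(i))$. The dimension of the affine cell corresponding to such a permissible filling of $\mathcal{Y}$ is the sum of the following quantities: (1) the number of pairs of boxes $(i,j)$ in the same Young diagram with $i<j$ and $\pi^{-1}(j)<\pi^{-1}(i)\le h(\pi^{-1}(k))$, where $k$ is the box directly above box $j$ (if there is no box above box $j$, the latter inequality is considered vacuously satisfied); (2) the number of pairs of boxes $(i,j)$ in different Young diagrams, with the diagram containing box $j$ to the left of the diagram containing box $i$, such that $h(\pi^{-1}(j))\ge\pi^{-1}(i)>\pi^{-1}(j)$.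
   Context: Multidiagram: for each generalized eigenspace of $M$, $M$ acts on it as the sum of a scalar $\lambda_j$ and a nilpotent operator $N_j$. The Young diagram of $N_j$ has one column per Jordan block of $N_j$, the columns having as many boxes as the sizes of the Jordan blocks, arranged in weakly decreasing height from left to right, left-aligned and bottom-aligned. The multidiagram $\mathcal{Y}$ is the collection of these Young diagrams, one for each generalized eigenspace, ordered from largest to smallest going from right to left. Boxes are indexed by $1,\dots,n$: in each diagram start with the rightmost box of the bottom row, increment leftwards along the row, then pass to the rightmost box of the next higher row, and so on; then add to the indices of each diagram the total number of boxes in the diagrams to the right of it. Choose a basis $e_1,\dots,e_n$ of $\mathbb{C}^n$, with $e_k$ in the generalized eigenspace whose diagram contains box $k$, such that $Me_k=\lambda e_k+e_j$ if box $k$ lies directly above box $j$, and $Me_k=\lambda e_k$ if there is no box below box $k$ ($\lambda$ the corresponding eigenvalue). $B\subset G=GL_n(\mathbb{C})$ is the group of upper triangular matrices with respect to this basis, $\mathfrak{b}$ its Lie algebra, $E_{ij}$ the matrix units. A Hessenberg space is a subspace $H$ with $\mathfrak{b}\subseteq H\subseteq\mathfrak{gl}_n(\mathbb{C})$ and $[\mathfrak{b},H]\subseteq H$. Hessenberg spaces correspond bijectively to functions $h:\{1,\dots,n\}\to\{1,\dots,n\}$ with $h(i)\ge\max\{i,h(i-1)\}$ for all $i$, via: $E_{ij}\in H$ if and only if $i\le h(j)$. The Hessenberg variety is $\mathcal{H}(M,H)=\{gB\in G/B: g^{-1}Mg\in H\}$; its cells are the nonempty intersections with the Schubert cells $B\pi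 B\subset G/B$, where $\pi\in S_n$ is identified with the permutation matrix $\pi e_i=e_{\pi(i)}$. *)

(* Defs.v *)
(* MathComp, with classical sets and the abstract real numbers of
   MathComp-Analysis; the complex numbers are R[i] for R : realType. *)
From HB Require Import structures.
From mathcomp Require Import all_boot all_order all_algebra all_fingroup.
From mathcomp Require Import complex.
From mathcomp Require Import boolp classical_sets functions reals.
From mathcomp Require Import mpoly.

Set Implicit Arguments.
Unset Strict Implicit.
Unset Printing Implicit Defensive.

Import GRing.Theory.

Local Open Scope classical_set_scope.
Local Open Scope ring_scope.

(* The diagrams are listed from right to left (the head of the sequence is the
   rightmost diagram). A diagram is given by the eigenvalue it is attached to
   and by the heights of its columns, listed from left to right. *)
Definition multidiagram (F : Type) := seq (F * seq nat).

Section Multidiagrams.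
Variable F : fieldType.
Implicit Type Y : multidiagram F.

Definition jordan_block (a : F) (m : nat) : 'M[F]_m :=
  \matrix_(i, j) ((i == j)%:R * a + (i.+1 == j :> nat)%:R).

Definition jordan_blocks Y : seq (F * nat) :=
  flatten [seq [seq (d.1, m) | m <- d.2] | d <- Y].

Definition jordan_matrix (s : seq (F * nat)) :
    'M[F]_(\sum_(b < size s) (nth (0%R, 0%N) s b).2) :=
  \mxdiag_(b < size s)
    jordan_block (nth (0, 0%N) s b).1 (nth (0, 0%N) s b).2.

Definition has_jordan_form n (M : 'M[F]_n) (s : seq (F * nat)) : Prop :=
  exists e : (\sum_(b < size s) (nth (0%R, 0%N) s b).2 = n)%N,
    similar_in unitmx M (castmx (e, e) (jordan_matrix s)).

(* Diagrams are compared by their number of boxes; diagrams with the same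
   number of boxes may come in any order. *)
Definition is_multidiagram n (M : 'M[F]_n) Y : Prop :=
  [/\ uniq [seq d.1 | d <- Y],
      all (fun d => [&& d.2 != [::], all (ltn 0) d.2 & sorted geq d.2]) Y,
      sorted (fun d d' => sumn d'.2 <= sumn d.2)%N Y
    & has_jordan_form M (jordan_blocks Y)].

(* Diagrams are numbered from right to left, rows from bottom to top and
   columns from left to right, all starting from 0. *)
Record box := Box { box_diagram : nat; box_row : nat; box_column : nat }.

Definition diagram_boxes (d : nat) (heights : seq nat) : seq box :=
  [seq Box d r c | r <- iota 0 (head 0%N heights),
                   c <- rev (iota 0 (count (ltn r) heights))].

Definition boxes Y : seq box :=
  flatten [seq diagram_boxes d (nth (0, [::]) Y d).2 | d <- iota 0 (size Y)].

(* Indices start from 0 instead of 1. *)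
Definition nth_box Y (k : nat) : box := nth (Box 0 0 0) (boxes Y) k.

Definition eigenvalue_at Y (k : nat) : F :=
  (nth (0, [::]) Y (box_diagram (nth_box Y k))).1.

Definition same_diagram Y (i j : nat) : bool :=
  box_diagram (nth_box Y i) == box_diagram (nth_box Y j).

Definition diagram_left_of Y (j i : nat) : bool :=
  (box_diagram (nth_box Y i) < box_diagram (nth_box Y j))%N.

Definition directly_above Y (k j : nat) : bool :=
  [&& same_diagram Y k j,
      box_column (nth_box Y k) == box_column (nth_box Y j)
    & box_row (nth_box Y k) == (box_row (nth_box Y j)).+1].

(* Operators act on column vectors; the basis vector e_k is the k-th column
   of P. *)
Definition adapted_basis n (M : 'M[F]_n) Y (P : 'M[F]_n) : Prop :=
  [/\ P \in unitmx,
      forall k : 'I_n,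
        (M - (eigenvalue_at Y k)%:M) ^+ n *m col k P = 0,
      forall k j : 'I_n, directly_above Y k j ->
        M *m col k P = eigenvalue_at Y k *: col k P + col j P
    & forall k : 'I_n, (forall j : 'I_n, ~~ directly_above Y k j) ->
        M *m col k P = eigenvalue_at Y k *: col k P].

End Multidiagrams.

Section Hessenberg.
Variables (F : fieldType) (n : nat).
Implicit Types (M P : 'M[F]_n) (H : {vspace 'M[F]_n}) (h : 'I_n -> 'I_n).
Implicit Type pi : 'S_n.

Definition operator_of P (A : 'M[F]_n) : 'M[F]_n := P *m A *m invmx P.
Definition matrix_of P (T : 'M[F]_n) : 'M[F]_n := invmx P *m T *m P.

Definition borel_algebra P : set 'M[F]_n :=
  [set T | forall i j : 'I_n, (j < i)%N -> matrix_of P T i j = 0].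

Definition borel P : set 'M[F]_n :=
  [set g | g \in unitmx] `&` borel_algebra P.

Definition hessenberg_space P H : Prop :=
  (forall X, borel_algebra P X -> X \in H) /\
  (forall X Z, borel_algebra P X -> Z \in H -> X *m Z - Z *m X \in H).

Definition hessenberg_function h : Prop :=
  (forall i : 'I_n, i <= h i)%N /\ (forall i j : 'I_n, i.+1 = j -> h i <= h j)%N.

Definition corresponding_function P H h : Prop :=
  forall i j : 'I_n, operator_of P (delta_mx i j) \in H <-> (i <= h j)%N.

(* The points of G/B are the cosets gB, as sets of matrices. *)
Definition flag P (g : 'M[F]_n) : set 'M[F]_n := [set g *m b | b in borel P].

Definition hessenberg_variety M P H : set (set 'M[F]_n) :=
  [set flag P g | g in
     [set g | g \in unitmx /\ invmx g *m M *m g \in H]].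

(* The operator sending e_i to e_(pi i). *)
Definition perm_operator P pi : 'M[F]_n :=
  operator_of P (\matrix_(i, j) (i == pi j)%:R).

Definition schubert_cell P pi : set (set 'M[F]_n) :=
  [set flag P (b *m perm_operator P pi) | b in borel P].

Definition hessenberg_cell M P H pi : set (set 'M[F]_n) :=
  schubert_cell P pi `&` hessenberg_variety M P H.

End Hessenberg.

Section AffineCells.
Variable F : fieldType.

Definition regular_map m k (X : set 'rV[F]_m) (f : 'rV[F]_m -> 'rV[F]_k) :
    Prop :=
  forall (x : 'rV[F]_m) (j : 'I_k), X x -> exists p q : {mpoly F[m]}, q.@[x 0] != 0 /\
    forall y : 'rV[F]_m, X y -> q.@[y 0] != 0 -> f y 0 j = p.@[y 0] / q.@[y 0].

(* Since G -> G/B is locally trivial in the Zariski topology, a map to G/B is a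
   morphism iff it lifts locally to a morphism to G, and a function on a
   locally closed subset of G/B is regular iff its pullback to G is regular. *)
Definition morphism_to_flags n d (P : 'M[F]_n) (f : 'rV[F]_d -> set 'M[F]_n) :
    Prop :=
  forall v : 'rV[F]_d, exists (q : {mpoly F[d]}) (s : 'rV[F]_d -> 'M[F]_n),
    [/\ q.@[v 0] != 0,
        regular_map [set w : 'rV[F]_d | q.@[w 0] != 0] (fun w => mxvec (s w))
      & forall w : 'rV[F]_d, q.@[w 0] != 0 -> s w \in unitmx /\ f w = flag P (s w)].

Definition morphism_from_flags n d (P : 'M[F]_n) (X : set (set 'M[F]_n))
    (f : set 'M[F]_n -> 'rV[F]_d) : Prop :=
  regular_map [set mxvec g | g in [set g | g \in unitmx /\ X (flag P g)]]
    (fun w => f (flag P (vec_mx w))).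

(* X is isomorphic, as a subvariety of G/B, to the affine space of
   dimension d. *)
Definition affine_cell_of_dim n (P : 'M[F]_n) (X : set (set 'M[F]_n))
    (d : nat) : Prop :=
  exists (f : 'rV[F]_d -> set 'M[F]_n) (g : set 'M[F]_n -> 'rV[F]_d),
    [/\ morphism_to_flags P f, morphism_from_flags P X g,
        forall v, X (f v) /\ g (f v) = v
      & forall x, X x -> f (g x) = x].

End AffineCells.

Section Fillings.
Variables (F : fieldType) (n : nat).
Implicit Types (Y : multidiagram F) (h : 'I_n -> 'I_n).

(* A filling is a permutation c, box i being filled with c i; the filling
   attached to pi is the inverse of pi. *)
Definition permissible Y h (c : 'S_n) : Prop :=
  forall i j : 'I_n, directly_above Y i j -> (c j <= h (c i))%N.

Definition same_diagram_pairs Y h (c : 'S_n) : {set 'I_n * 'I_n} :=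
  [set p : 'I_n * 'I_n | [&& same_diagram Y p.1 p.2, (p.1 < p.2)%N,
     (c p.2 < c p.1)%N
   & [forall k : 'I_n, directly_above Y k p.2 ==> (c p.1 <= h (c k))%N]]]%SET.

Definition different_diagram_pairs Y h (c : 'S_n) : {set 'I_n * 'I_n} :=
  [set p : 'I_n * 'I_n | [&& diagram_left_of Y p.2 p.1,
     (c p.1 <= h (c p.2))%N & (c p.2 < c p.1)%N]]%SET.

End Fillings.

(* Main.v *)
(* Every point of B pi B / B is u pi B for a unique unipotent u in B with
   pi^-1 u pi lower triangular: off the diagonal, u_ab can be nonzero only if
   a < b and c a > c b, where c = pi^-1.  In the adapted basis, with
   X = u^-1 M u, this point lies in the Hessenberg variety iff X_ab = 0
   whenever c a > h (c b).  From u X = M u,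

     X_ab = lam_a u_ab + sum_(m above a) u_mb - sum_(m > a) u_am X_mb,

   so once the rows of u below row a are known these are affine equations in
   row a of u.  If b is in another diagram than a, the last entry of row a in
   this equation is u_ab, with coefficient lam_a - lam_b.  If a and b are in the
   same diagram it is u_aj, with j the box below b, and its coefficient is -1,
   since the lowest nonzero entry of column b of X above the diagonal, within
   the diagram, is a 1 in row j; for j < a, or when there is no such j, the
   equation is trivial, and j = a is excluded because the filling is
   permissible.  Distinct equations of row a thus have distinct pivots, all of
   them genuine variables, and the pivots can be eliminated.  The remaining
   variables are the pairs that are counted. *)

Require Import Defs.
From HB Require Import structures.
From mathcomp Require Import all_boot all_order all_algebra all_fingroup.
From mathcomp Require Import complex.
From mathcomp Require Import boolp classical_sets functions reals.
From mathcomp Require Import mpoly zify.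

Set Implicit Arguments.
Unset Strict Implicit.
Unset Printing Implicit Defensive.

Import GRing.Theory.

Local Open Scope classical_set_scope.
Local Open Scope ring_scope.

(** * Numbering of the boxes *)

Section BoxOrder.

Definition box_key (b : box) := (box_diagram b, box_row b, box_column b).

Definition box_of_key (t : nat * nat * nat) := Box t.1.1 t.1.2 t.2.

Lemma box_keyK : cancel box_key box_of_key.
Proof. by case. Qed.

HB.instance Definition _ := Equality.copy box (can_type box_keyK).

(** The order in which boxes are numbered. Diagrams already count from the right, whereas columns
    count from the left; hence the reversed comparison of columns. *)
Definition box_lt (b b' : box) : bool :=
  (box_diagram b < box_diagram b')%N ||
  (box_diagram b == box_diagram b') &&
    ((box_row b < box_row b')%N ||
     (box_row b == box_row b') && (box_column b' < box_column b)%N).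

Lemma box_lt_trans : transitive box_lt.
Proof. by move=> [d r k] [d' r' k'] [d'' r'' k'']; rewrite /box_lt /=; lia. Qed.

Lemma box_lt_irr : irreflexive box_lt.
Proof. by move=> [d r k]; rewrite /box_lt /=; lia. Qed.

Lemma pairwise_flatten_map (S T : eqType) (lt : rel S) (R : rel T)
    (f : S -> seq T) (s : seq S) :
  pairwise lt s -> {in s, forall x, pairwise R (f x)} ->
  (forall x y, lt x y -> allrel R (f x) (f y)) ->
  pairwise R (flatten [seq f x | x <- s]).
Proof.
move=> + + fR; elim: s => //= x s IHs /andP[/allP ltx lts] sR.
rewrite pairwise_cat sR ?mem_head // IHs ?andbT //; last first.
  by move=> y sy; apply: sR; rewrite inE sy orbT.
apply/allrelP => a b fa /flattenP[_ /mapP[y sy ->] fb].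
by have /allrelP := fR _ _ (ltx y sy); apply.
Qed.

Lemma pairwise_diagram_boxes d hs : pairwise box_lt (diagram_boxes d hs).
Proof.
apply: (@pairwise_flatten_map _ _ ltn).
- by rewrite -sorted_pairwise ?iota_ltn_sorted //; exact: ltn_trans.
- move=> r _; rewrite pairwise_map -sorted_pairwise; last first.
    by move=> ? ? ?; rewrite /= /box_lt /=; lia.
  rewrite rev_sorted; apply: sub_sorted (iota_ltn_sorted _ _) => k k' /=.
  by rewrite /box_lt /=; lia.
- move=> r r' ltr; apply/allrelP => _ _ /mapP[k _ ->] /mapP[k' _ ->].
  by rewrite /box_lt /=; lia.
Qed.

Lemma mem_diagram_boxes d hs b :
  (b \in diagram_boxes d hs) =
  [&& box_diagram b == d, (box_row b < head 0 hs)%N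
    & (box_column b < count (ltn (box_row b)) hs)%N].
Proof.
apply/allpairsPdep/and3P => [[r [k [+ + ->]]]|].
  by rewrite mem_rev !mem_iota.
case: b => d' r k /= [/eqP-> ltr ltk]; exists r, k.
by rewrite mem_rev !mem_iota.
Qed.

(** Double counting by rows and by columns. Weak decrease makes the head the largest height, so the
    range of rows cuts off no column. *)
Lemma size_diagram_boxes d hs :
  sorted geq hs -> size (diagram_boxes d hs) = sumn hs.
Proof.
move=> hs_sorted.
have hs_le : all (fun x => x <= head 0 hs)%N hs.
  case: hs hs_sorted => //= x s; rewrite path_sortedE; last first.
    by move=> ? ? ? /=; lia.
  by case/andP=> + _; rewrite leqnn.
rewrite size_allpairs_dep.
under eq_map do rewrite size_rev size_iota.
move: (head _ _) hs_le => m {hs_sorted}.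
elim: hs => [_|x s IHs /= /andP[lexm sm]]; first by elim: (iota 0 m).
rewrite -{}IHs //.
have x_count : x = count (fun r => r < x)%N (iota 0 m).
  rewrite -(subnKC lexm) iotaD count_cat add0n.
  have /eqP-> : count (fun r => r < x)%N (iota 0 x) == x.
    rewrite -[X in _ == X](size_iota 0 x) -all_count.
    by apply/allP => r; rewrite mem_iota.
  suff -> : count (fun r => r < x)%N (iota x (m - x)) = 0%N by rewrite addn0.
  apply/eqP; rewrite -leqn0 leqNgt -has_count; apply/hasPn => r.
  by rewrite mem_iota; lia.
rewrite [X in (X + _)%N]x_count.
by elim: (iota 0 m) => //= r t ->; lia.
Qed.

Variables (F : fieldType) (Y : multidiagram F).

Lemma sorted_boxes : sorted box_lt (boxes Y).
Proof.
rewrite sorted_pairwise; last exact: box_lt_trans.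
apply: (@pairwise_flatten_map _ _ ltn).
- by rewrite -sorted_pairwise ?iota_ltn_sorted //; exact: ltn_trans.
- by move=> d _; exact: pairwise_diagram_boxes.
- move=> d d' ltd; apply/allrelP => a b; rewrite !mem_diagram_boxes /box_lt.
  by lia.
Qed.

Lemma mem_boxes b :
  (b \in boxes Y) =
  [&& (box_diagram b < size Y)%N,
      (box_row b < head 0 (nth (0%R, [::]) Y (box_diagram b)).2)%N
    & (box_column b <
        count (ltn (box_row b)) (nth (0%R, [::]) Y (box_diagram b)).2)%N].
Proof.
apply/flatten_mapP/idP => [[d]|/and3P[ltd ltr ltk]].
  by rewrite mem_iota mem_diagram_boxes => ltd /and3P[/eqP-> -> ->]; lia.
exists (box_diagram b); first by rewrite mem_iota.
by rewrite mem_diagram_boxes eqxx ltr.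
Qed.

Lemma box_below_mem d r k : Box d r.+1 k \in boxes Y -> Box d r k \in boxes Y.
Proof.
rewrite !mem_boxes /= => /and3P[-> ltr ltk] /=; rewrite (ltnW ltr) /=.
by apply: leq_trans ltk _; apply: sub_count => m /= /ltnW.
Qed.

Lemma size_boxes :
  all (fun d => sorted geq d.2) Y ->
  size (boxes Y) = \sum_(b < size (jordan_blocks Y))
                     (nth (0%R, 0%N) (jordan_blocks Y) b).2.
Proof.
move=> Ysorted.
rewrite -(big_mkord predT (fun i => (nth (0%R, 0%N) (jordan_blocks Y) i).2)).
rewrite -(big_nth (0%R, 0%N) predT (fun x : F * nat => x.2)).
rewrite /boxes /jordan_blocks size_flatten /shape -map_comp.
transitivity (sumn [seq sumn d.2 | d <- Y]).
  rewrite -[in RHS](mkseq_nth (0%R, [::]) Y) /mkseq -map_comp.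
  congr sumn; apply/eq_in_map => d; rewrite mem_iota /= => ltd.
  by rewrite size_diagram_boxes //; apply: (allP Ysorted); exact: mem_nth.
rewrite big_flatten big_map sumnE big_map; apply: eq_bigr => d _.
by rewrite big_map sumnE.
Qed.

Section Indices.
Variables (n : nat) (le_n : (n <= size (boxes Y))%N).
Implicit Types i j k l : 'I_n.

(** Reduces the order facts below to arithmetic on coordinates; [le_n] keeps indices away from the
    default box. *)
Lemma nth_box_ltE i j : (i < j)%N = box_lt (nth_box Y i) (nth_box Y j).
Proof.
have lt_size (x : 'I_n) : (x < size (boxes Y))%N.
  exact: leq_trans (ltn_ord x) le_n.
have homo := sorted_ltn_nth box_lt_trans (Box 0 0 0) sorted_boxes.
case: (ltngtP i j) => [ltij|ltji|/val_inj->]; last by rewrite box_lt_irr.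
  by rewrite (homo _ _ (lt_size i) (lt_size j)).
apply/esym/negbTE/negP => lt_ij.
have := box_lt_trans (homo _ _ (lt_size j) (lt_size i) ltji) lt_ij.
by rewrite box_lt_irr.
Qed.

Definition diagram_of i : nat := box_diagram (nth_box Y i).

Lemma diagram_of_homo i j : (i <= j)%N -> (diagram_of i <= diagram_of j)%N.
Proof.
rewrite leq_eqVlt => /orP[/eqP/val_inj->//|].
by rewrite nth_box_ltE /box_lt /diagram_of; lia.
Qed.

Lemma directly_above_diagram k j :
  directly_above Y k j -> diagram_of k = diagram_of j.
Proof. by case/and3P => /eqP. Qed.

Lemma directly_above_lt k j : directly_above Y k j -> (j < k)%N.
Proof.
by rewrite nth_box_ltE /directly_above /same_diagram /box_lt; lia.
Qed.

Lemma directly_above_mono k j k' j' :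
  directly_above Y k j -> directly_above Y k' j' -> (k < k')%N = (j < j')%N.
Proof.
by rewrite !nth_box_ltE /directly_above /same_diagram /box_lt; lia.
Qed.

Lemma bottom_lt k l j :
  (forall j', ~~ directly_above Y k j') -> directly_above Y l j ->
  diagram_of l = diagram_of k -> (k < l)%N.
Proof.
move=> k_bottom lj lk.
suff k0 : box_row (nth_box Y k) = 0%N.
  move: lj lk; rewrite nth_box_ltE /directly_above /diagram_of /box_lt; lia.
have k_lt : (k < size (boxes Y))%N by exact: leq_trans (ltn_ord k) le_n.
case E : (nth_box Y k) => [d [|r] c] //=.
have kY : Box d r.+1 c \in boxes Y by rewrite -E mem_nth.
have bY := box_below_mem kY; pose b := index (Box d r c) (boxes Y).
have nth_b : nth_box Y b = Box d r c by rewrite /nth_box nth_index.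
(* The hypothesis [k_bottom] ranges over ['I_n], so the box below [k] must be shown to have an index
   less than [n]. *)
have b_lt : (b < k)%N.
  rewrite ltnNge leq_eqVlt; apply/negP => /orP[/eqP kb|kb].
    by move: nth_b; rewrite -kb E => -[]; lia.
  have := sorted_ltn_nth box_lt_trans (Box 0 0 0) sorted_boxes.
  move=> /(_ k b); rewrite !inE k_lt index_mem bY => /(_ isT isT kb).
  by rewrite -!/(nth_box _ _) nth_b E /box_lt /=; lia.
have := k_bottom (Ordinal (ltn_trans b_lt (ltn_ord k))).
by rewrite /directly_above /same_diagram E /= nth_b /= !eqxx.
Qed.

End Indices.
End BoxOrder.

(** * Triangular recursions and rational functions *)

Section Fixpoints.
Variables (T : finType) (V : nmodType) (mu : T -> nat) (step : (T -> V) -> T -> V).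
Hypothesis step_local : forall f g x,
  (forall y, (mu y < mu x)%N -> f y = g y) -> step f x = step g x.

(** Recursion on the rank [mu], encoded as a finite iteration: an invariant of [step], such as
    rationality in parameters, then passes to the fixed point by induction on the number of
    rounds. *)
Definition local_fix : T -> V := iter (\max_x mu x).+1 step (fun=> 0).

Lemma local_fixE : step local_fix =1 local_fix.
Proof.
have stable k x : (mu x < k)%N ->
    iter k.+1 step (fun=> 0) x = iter k step (fun=> 0) x.
  elim: k x => // k IHk x ltx; apply: step_local => y lty; apply: IHk.
  exact: leq_trans lty ltx.
by move=> x; rewrite /local_fix -iterS stable // ltnS leq_bigmax.
Qed.

Lemma local_fix_unique f : step f =1 f -> f =1 local_fix.
Proof.
move=> fixf x; have [k] := ubnP (mu x); elim: k x => // k IHk x ltx.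
rewrite -fixf -local_fixE; apply: step_local => y lty; apply: IHk.
by apply: leq_trans lty _; rewrite -ltnS.
Qed.

End Fixpoints.

Section RationalFunctions.
Variables (F : fieldType) (m : nat).
Implicit Types (X : set 'rV[F]_m) (f g : 'rV[F]_m -> F).

(** Stronger than [regular_map], where the fraction may vary with the point; a single fraction is
    easier to compose. *)
Definition rational_on X f : Prop :=
  exists p q : {mpoly F[m]}, forall y, X y ->
    q.@[y 0] != 0 /\ f y = p.@[y 0] / q.@[y 0].

Lemma rational_on_ext X f g :
  (forall y, X y -> f y = g y) -> rational_on X f -> rational_on X g.
Proof.
by move=> fg [p [q fE]]; exists p, q => y Xy; rewrite -fg //; apply: fE.
Qed.

Lemma rational_on_cst X a : rational_on X (fun=> a).
Proof.
by exists a%:MP, 1 => y _; rewrite mevalC meval1 divr1 oner_neq0.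
Qed.

Lemma rational_on_coord X i : rational_on X (fun y => y 0 i).
Proof. by exists 'X_i, 1 => y _; rewrite mevalXU meval1 divr1 oner_neq0. Qed.

Lemma rational_on_add X f g :
  rational_on X f -> rational_on X g -> rational_on X (fun y => f y + g y).
Proof.
move=> [p [q fE]] [p' [q' gE]]; exists (p * q' + p' * q), (q * q') => y Xy.
have [q0 ->] := fE y Xy; have [q0' ->] := gE y Xy.
by rewrite mevalD !mevalM mulf_neq0 // addf_div.
Qed.

Lemma rational_on_mul X f g :
  rational_on X f -> rational_on X g -> rational_on X (fun y => f y * g y).
Proof.
move=> [p [q fE]] [p' [q' gE]]; exists (p * p'), (q * q') => y Xy.
have [q0 ->] := fE y Xy; have [q0' ->] := gE y Xy.
by rewrite !mevalM mulf_neq0 // mulf_div.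
Qed.

Lemma rational_on_inv X f :
  (forall y, X y -> f y != 0) -> rational_on X f ->
  rational_on X (fun y => (f y)^-1).
Proof.
move=> f0 [p [q fE]]; exists q, p => y Xy; have [q0 fy] := fE y Xy.
have := f0 y Xy; rewrite fy invf_div; split=> //.
by apply: contra_neq H => ->; rewrite mul0r.
Qed.

Lemma rational_on_opp X f :
  rational_on X f -> rational_on X (fun y => - f y).
Proof.
move=> Xf; apply: (@rational_on_ext _ (fun y => -1 * f y)).
  by move=> y _; rewrite mulN1r.
exact: rational_on_mul (rational_on_cst _ _) Xf.
Qed.

Lemma rational_on_sum X I (r : seq I) (Q : pred I) (f : I -> 'rV[F]_m -> F) :
  (forall i, Q i -> rational_on X (f i)) ->
  rational_on X (fun y => \sum_(i <- r | Q i) f i y).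
Proof.
move=> Xf; elim: r => [|i r IHr].
  apply: rational_on_ext (rational_on_cst _ 0) => y _.
  by rewrite big_nil.
case Qi : (Q i).
  apply: rational_on_ext (rational_on_add (Xf i Qi) IHr) => y _.
  by rewrite big_cons Qi.
by apply: rational_on_ext IHr => y _; rewrite big_cons Qi.
Qed.

Lemma regular_mapP k X (f : 'rV[F]_m -> 'rV[F]_k) :
  (forall j, rational_on X (fun y => f y 0 j)) -> regular_map X f.
Proof.
move=> Xf x j Xx; have [p [q fE]] := Xf j; exists p, q.
by have [q0 _] := fE x Xx; split=> // y /fE[].
Qed.

End RationalFunctions.

Lemma rational_on_mulmx (F : fieldType) (m p q r : nat) (X : set 'rV[F]_m)
    (f : 'rV[F]_m -> 'M[F]_(p, q)) (g : 'rV[F]_m -> 'M[F]_(q, r)) :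
  (forall i j, rational_on X (fun y => f y i j)) ->
  (forall i j, rational_on X (fun y => g y i j)) ->
  forall i j, rational_on X (fun y => (f y *m g y) i j).
Proof.
move=> Xf Xg i j.
apply: (@rational_on_ext _ _ _ (fun y => \sum_k f y i k * g y k j)).
  by move=> y _; rewrite mxE.
by apply: rational_on_sum => k _; apply: rational_on_mul.
Qed.

Lemma invmx_mul (R : comUnitRingType) n (x y : 'M[R]_n) :
  x \in unitmx -> y \in unitmx -> invmx (x *m y) = invmx y *m invmx x.
Proof.
move=> x1 y1; have xy1 : x *m y \in unitmx by rewrite unitmx_mul x1.
apply: (can_inj (mulKmx xy1)).
by rewrite mulmxV // -mulmxA [y *m _]mulmxA mulmxV // mul1mx mulmxV.
Qed.

(** * Triangular matrices and LU factorisation *)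

Section Triangular.
Variables (F : fieldType) (n : nat).
Implicit Types A B : 'M[F]_n.

Definition upper A : Prop := forall i j : 'I_n, (j < i)%N -> A i j = 0.

Definition unipotent A : Prop := upper A /\ forall i, A i i = 1.

Lemma upper_det A : upper A -> \det A = \prod_i A i i.
Proof.
move=> uA; rewrite -det_tr det_trig; last first.
  by apply/is_trig_mxP => i j ltij; rewrite mxE uA.
by apply: eq_bigr => i _; rewrite mxE.
Qed.

Lemma upper_unitmx A : upper A -> (A \in unitmx) = [forall i, A i i != 0].
Proof.
move=> uA; rewrite unitmxE upper_det // unitfE.
by apply/prodf_neq0/forallP => A0 i *; exact: A0.
Qed.

Lemma unipotent_unitmx A : unipotent A -> A \in unitmx.
Proof.
case=> uA A1; rewrite upper_unitmx //.
by apply/forallP => i; rewrite A1 oner_neq0.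
Qed.

Lemma upper1 : upper 1%:M.
Proof. by move=> i j ltji; rewrite mxE -val_eqE gtn_eqF. Qed.

Lemma upper_mul A B : upper A -> upper B -> upper (A *m B).
Proof.
move=> uA uB i j ltji; rewrite mxE big1 // => k _.
have [ltki|leik] := ltnP k i; first by rewrite uA ?mul0r.
by rewrite uB ?mulr0 //; exact: leq_trans leik.
Qed.

Lemma upper_diag_mul A B i :
  upper A -> upper B -> (A *m B) i i = A i i * B i i.
Proof.
move=> uA uB; rewrite mxE (bigD1 i) //= big1 ?addr0 // => k neki.
have [ltki|ltik|/val_inj eqki] := ltngtP k i; last by rewrite eqki eqxx in neki.
  by rewrite uA ?mul0r.
by rewrite uB ?mulr0.
Qed.

Lemma upper_mulKl A B :
  upper A -> A \in unitmx -> upper (A *m B) -> upper B.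
Proof.
move=> uA; rewrite upper_unitmx // => /forallP A0 uAB i j.
have [k] := ubnP (n - i)%N; elim: k i j => // k IHk i j lti ltji.
have := uAB i j ltji; rewrite mxE (bigD1 i) //= big1 ?addr0 => [/eqP|l neli].
  by rewrite mulf_eq0 (negbTE (A0 i)) => /eqP.
have [ltli|ltil|/val_inj eqli] := ltngtP l i; last by rewrite eqli eqxx in neli.
  by rewrite uA ?mul0r.
by rewrite IHk ?mulr0 //; have := ltn_ord l; lia.
Qed.

Lemma upper_inv A : upper A -> A \in unitmx -> upper (invmx A).
Proof.
by move=> uA A1; apply: (@upper_mulKl A) => //; rewrite mulmxV //; exact: upper1.
Qed.

(* The Doolittle recursion expresses the factors rationally in the entries of
   the product. *)
Lemma lu_rational m (X : set 'rV[F]_m) (L B A : 'rV[F]_m -> 'M[F]_n) :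
  (forall y, X y -> unipotent (L y)^T) ->
  (forall y, X y -> upper (B y) /\ B y \in unitmx) ->
  (forall y, X y -> A y = L y *m B y) ->
  (forall i j, rational_on X (fun y => A y i j)) ->
  forall i j, rational_on X (fun y => L y i j).
Proof.
move=> uL uB AE ratA.
suff rat k : forall i j : 'I_n,
  ((j <= k)%N -> rational_on X (fun y => L y i j)) /\
                ((i <= k)%N -> rational_on X (fun y => B y i j)).
  by move=> i j; apply: (rat n i j).1; exact: ltnW.
have Lup y (i' j' : 'I_n) : X y -> (i' < j')%N -> L y i' j' = 0.
  by move=> /uL[/(_ j' i')]; rewrite mxE.
have L1 y i' : X y -> L y i' i' = 1 by move=> /uL[_ /(_ i')]; rewrite mxE.
have B0 y i' : X y -> B y i' i' != 0.
  by move=> /uB[uBy]; rewrite upper_unitmx // => /forallP.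
elim/ltn_ind: k => k IHk.
have ratS (i j l : 'I_n) : (l < k)%N ->
    rational_on X (fun y => L y i l * B y l j).
  move=> ltlk; apply: rational_on_mul.
    by case: (IHk l ltlk i l) => + _; apply.
  by case: (IHk l ltlk l j) => _; apply.
(* The rows of [B] come first, since column [j] of [L] is then obtained by dividing by the diagonal
   entry of [B] in row [j]. *)
have ratB (i j : 'I_n) : (i <= k)%N -> rational_on X (fun y => B y i j).
  move=> leik; apply: (@rational_on_ext _ _ _
    (fun y => A y i j - \sum_(l < n | (l < i)%N) L y i l * B y l j)).
    move=> y Xy; rewrite AE // mxE (bigID (fun l : 'I_n => l < i)%N) /=.
    rewrite addrAC subrr add0r (bigD1 i) ?ltnn //= L1 // mul1r big1 ?addr0 //.
    move=> l /andP[geli neli]; rewrite Lup ?mul0r //.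
    by move: neli; rewrite -val_eqE /=; lia.
  apply: rational_on_add => //; apply: rational_on_opp.
  by apply: rational_on_sum => l ltli; apply: ratS; exact: leq_trans leik.
move=> i j; split; last exact: ratB.
move=> lejk; apply: (@rational_on_ext _ _ _
    (fun y => (A y i j - \sum_(l < n | (l < j)%N) L y i l * B y l j)
              * (B y j j)^-1)).
  move=> y Xy; have [uBy _] := uB y Xy.
  rewrite AE // mxE (bigID (fun l : 'I_n => l < j)%N) /=.
  rewrite addrAC subrr add0r (bigD1 j) ?ltnn //= big1 ?addr0 ?mulfK ?B0 //.
  move=> l /andP[gelj nelj]; rewrite uBy ?mulr0 //.
  by move: nelj; rewrite -val_eqE /=; lia.
apply: rational_on_mul; last first.
  by apply: rational_on_inv; [move=> y; exact: B0 | exact: ratB].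
apply: rational_on_add => //; apply: rational_on_opp.
by apply: rational_on_sum => l ltlj; apply: ratS; exact: leq_trans lejk.
Qed.

End Triangular.

(** * Representatives of Schubert cells *)

Section NormalForm.
Variables (F : fieldType) (n : nat) (c : 'S_n).
Implicit Types u t b X : 'M[F]_n.

(* With pi = c^-1, these are the elements of the intersection of U with
   pi U^- pi^-1, which represent each point of B pi B / B exactly once. *)
Definition normal_form u : Prop :=
  forall i j : 'I_n, ~~ ((i < j) && (c j < c i))%N -> u i j = (i == j)%:R.

Lemma normal_form_unipotent u : normal_form u -> unipotent u.
Proof.
move=> nu; split=> [i j ltji|i]; rewrite nu ?eqxx ?ltnn //; last by lia.
by rewrite -val_eqE gtn_eqF.
Qed.

Lemma conj_perm_mxE X i j :
  (invmx (perm_mx c) *m X *m perm_mx c) (c i) (c j) = X i j.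
Proof.
have -> : invmx (perm_mx c) = perm_mx c^-1 :> 'M[F]_n.
  apply: (can_inj (mulKmx (unitmx_perm F c))).
  by rewrite mulmxV ?unitmx_perm // -perm_mxM mulgV perm_mx1.
by rewrite -row_permE -[X in _ *m perm_mx X]invgK -col_permE !mxE !permK.
Qed.

(** Off the diagonal, [u] is supported where [c j < c i], and relabelling by [c] moves these
    positions below the diagonal; hence the transpose. *)
Lemma normal_form_conj_unipotent u :
  normal_form u -> unipotent (invmx (perm_mx c) *m u *m perm_mx c)^T.
Proof.
move=> nu; split=> [i j ltji|i]; rewrite mxE -[ i ](permKV c).
  rewrite -[j](permKV c) conj_perm_mxE nu ?permKV; last by lia.
  by rewrite (inj_eq perm_inj) -val_eqE ltn_eqF.
by rewrite conj_perm_mxE nu ?ltnn ?eqxx.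
Qed.

Lemma upper_perm_conj t :
  (forall i j : 'I_n, (c j < c i)%N -> t i j = 0) ->
  upper (invmx (perm_mx c) *m t *m perm_mx c).
Proof.
move=> ct i j ltji; rewrite -[ i ](permKV c) -[j](permKV c) conj_perm_mxE.
by rewrite ct ?permKV.
Qed.

(** After conjugation by the permutation matrix, [b] is a quotient of two lower unipotent matrices.
    Being upper triangular as well, it is the identity. *)
Lemma normal_form_unique u u' b :
  normal_form u -> normal_form u' -> upper b ->
  u *m perm_mx c = u' *m perm_mx c *m b -> u = u'.
Proof.
move=> nu nu' ub uu'; set W := perm_mx c in uu' *.
have W1 : W \in unitmx by exact: unitmx_perm.
pose L := invmx W *m u *m W; pose L' := invmx W *m u' *m W.
have LL' : L = L' *m b by rewrite /L /L' -!mulmxA uu' !mulmxA.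
have [uL L1] := normal_form_conj_unipotent nu.
have uniL' := normal_form_conj_unipotent nu'; have [uL' L1'] := uniL'.
have L'1 := unipotent_unitmx uniL'.
have LL't : L^T = b^T *m L'^T by rewrite LL' trmx_mul.
have lb : upper b^T.
  by rewrite -(mulmxK L'1 b^T) -LL't; apply: upper_mul => //; exact: upper_inv.
suff b1 : b = 1%:M.
  by rewrite b1 mulmx1 in uu'; rewrite -(mulmxK W1 u) uu' mulmxK.
apply/matrixP => i j; rewrite mxE.
have [ltij|ltji|/val_inj->] := ltngtP i j.
- by have := lb j i ltij; rewrite mxE => ->; rewrite -val_eqE ltn_eqF.
- by rewrite ub // -val_eqE gtn_eqF.
- have := upper_diag_mul j lb uL'; rewrite -LL't L1 L1' mulr1 mxE => <-.
  by rewrite eqxx.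
Qed.

(** The last property of [t] lets it be moved past the permutation matrix and absorbed into the
    Borel subgroup, leaving [u] as representative. Entries are found by increasing distance from the
    diagonal: entry (i, j) of the product determines [u i j] at an inversion, where [t i j] is 0,
    and [t i j] elsewhere. *)
Lemma bruhat_factor b :
  upper b -> b \in unitmx ->
  exists u t, [/\ normal_form u, b = u *m t, upper t, t \in unitmx
    & forall i j, (c j < c i)%N -> t i j = 0].
Proof.
move=> ub b1; have b0 i : b i i != 0.
  by move: b1; rewrite upper_unitmx // => /forallP.
pose inv (i j : 'I_n) := ((i < j) && (c j < c i))%N.
pose inner (v : bool * 'I_n * 'I_n -> F) (i j : 'I_n) :=
  \sum_(k < n | (i < k < j)%N) v (false, i, k) * v (true, k, j).
(* The Boolean selects the matrix: [true] for [t], [false] for [u]. *)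
pose step v (x : bool * 'I_n * 'I_n) := let: (s, i, j) := x in
  if s then if inv i j then 0 else if (i <= j)%N then b i j - inner v i j else 0
  else if inv i j then (b i j - inner v i j) / v (true, j, j) else (i == j)%:R.
pose mu (x : bool * 'I_n * 'I_n) := (x.2 - x.1.2)%N.
have inner_local f g (i j : 'I_n) :
    (forall y, (mu y < j - i)%N -> f y = g y) -> inner f i j = inner g i j.
  by move=> fg; apply: eq_bigr => k ltk; rewrite !fg // /mu /=; lia.
have step_local f g x :
    (forall y, (mu y < mu x)%N -> f y = g y) -> step f x = step g x.
  case: x => [[s i] j]; rewrite /mu /= => /[dup] fg /inner_local->.
  case: s => //; case: ifP => // /andP[ltij _].
  by rewrite fg //= subnn subn_gt0.
have fixE := local_fixE step_local; set v := local_fix _ _ in fixE.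
pose u := \matrix_(i, j) v (false, i, j); pose t := \matrix_(i, j) v (true, i, j).
have nu : normal_form u.
  by move=> i j /negbTE nij; rewrite mxE -fixE /= /inv nij.
have ut : upper t.
  move=> i j ltji; rewrite mxE -fixE /= /inv.
  by case: ifP => // _; rewrite leqNgt ltji.
have [uu u1] := normal_form_unipotent nu.
have tdiag i : t i i = b i i.
  rewrite mxE -fixE /= /inv ltnn leqnn /= /inner big1 ?subr0 // => k.
  by lia.
have but : b = u *m t.
  apply/matrixP => i j; have [ltji|] := ltnP j i.
    by rewrite ub // upper_mul.
  rewrite leq_eqVlt => /orP[/eqP/val_inj->|ltij].
    by rewrite upper_diag_mul // u1 mul1r tdiag.
  have neij : i != j by rewrite -val_eqE ltn_eqF.
  have -> : (u *m t) i j = t i j + u i j * t j j + inner v i j.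
    rewrite mxE (bigD1 i) //= (bigD1 j) ?(eq_sym j) //= u1 mul1r addrA.
    congr (_ + _); rewrite /inner (bigID (fun k : 'I_n => i < k < j)%N) /=.
    rewrite [X in _ + X]big1 ?addr0 => [|k]; last first.
      rewrite -!val_eqE /= => /andP[/andP[nek nek'] /nandP].
      case=> [leki|lejk]; first by rewrite uu ?mul0r //; lia.
      by rewrite ut ?mulr0 //; lia.
    apply: eq_big => [k|k _]; last by rewrite !mxE.
    by rewrite -!val_eqE /=; lia.
  have tj0 : v (true, j, j) != 0 by have := b0 j; rewrite -tdiag mxE.
  rewrite !mxE -(fixE (true, i, j)) -(fixE (false, i, j)) /=.
  case: ifP => _; first by rewrite add0r divfK // subrK.
  by rewrite (ltnW ltij) (negbTE neij) mul0r addr0 subrK.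
exists u, t; split=> // [|i j ltc].
  by rewrite upper_unitmx //; apply/forallP => i; rewrite tdiag.
rewrite mxE -fixE /= /inv; rewrite ltc andbT; case: (ltnP i j) => // leji.
case: (leqP i j) => // leij; have /val_inj eqij : i = j :> nat.
  by apply/eqP; rewrite eqn_leq leij.
by rewrite eqij ltnn in ltc.
Qed.

End NormalForm.

(** * Solving the equations row by row *)

Section RowReduction.
Variables (F : fieldType) (n : nat).
Variables (dg : 'I_n -> nat) (lam : 'I_n -> F) (above : rel 'I_n).
Hypothesis dg_homo : forall i j : 'I_n, (i <= j)%N -> (dg i <= dg j)%N.
Hypothesis lam_eq : forall i j : 'I_n, (lam i == lam j) = (dg i == dg j).
Hypothesis above_dg : forall k j : 'I_n, above k j -> dg k = dg j.
Hypothesis above_lt : forall k j : 'I_n, above k j -> (j < k)%N.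
Hypothesis above_mono : forall k j k' j' : 'I_n,
  above k j -> above k' j' -> (k < k')%N = (j < j')%N.
Hypothesis above_bottom : forall k l j : 'I_n,
  (forall j', ~~ above k j') -> above l j -> dg l = dg k -> (k < l)%N.

Lemma above_injl k j j' : above k j -> above k j' -> j = j'.
Proof.
move=> kj kj'; apply/val_inj; have := above_mono kj kj'.
by have := above_mono kj' kj; rewrite ltnn; case: ltngtP.
Qed.

Lemma above_injr k k' j : above k j -> above k' j -> k = k'.
Proof.
move=> kj kj'; apply/val_inj; have := above_mono kj kj'.
by have := above_mono kj' kj; rewrite ltnn; case: ltngtP.
Qed.

(** The Jordan-type matrix of the operator in an adapted basis. *)
Definition operator_matrix : 'M[F]_n :=
  \matrix_(a, b) (lam a *+ (a == b) + (above b a)%:R).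

Notation A := operator_matrix.

Lemma operator_matrix_mulE (u : 'M[F]_n) a b :
  (A *m u) a b = lam a * u a b + \sum_(m | above m a) u m b.
Proof.
rewrite mxE.
under eq_bigr do rewrite mxE mulrDl.
rewrite big_split /=; congr (_ + _).
  rewrite (bigD1 a) //= eqxx big1 ?addr0 // => m nema.
  by rewrite eq_sym (negbTE nema) mul0r.
by rewrite [RHS]big_mkcond; apply: eq_bigr => m _; case: above;
   rewrite ?mul1r ?mul0r.
Qed.

Lemma operator_matrix_upper : upper A.
Proof.
move=> a b ltba; rewrite mxE -val_eqE gtn_eqF // add0r.
by case: (boolP (above b a)) => // /above_lt; lia.
Qed.

(* X = u^-1 A u, read row by row from the bottom. *)
Lemma conj_rowP (u X : 'M[F]_n) :
  unipotent u ->
  u *m X = A *m u <->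
  forall a b, X a b = lam a * u a b + \sum_(m | above m a) u m b
                      - \sum_(m < n | (a < m)%N) u a m * X m b.
Proof.
case=> uu u1.
have uXE a b : (u *m X) a b = X a b + \sum_(m < n | (a < m)%N) u a m * X m b.
  rewrite mxE (bigD1 a) //= u1 mul1r; congr (_ + _).
  rewrite [LHS](bigID (fun m : 'I_n => a < m)%N) /= [X in _ + X]big1 ?addr0.
    apply: eq_bigl => m; rewrite -val_eqE /=; lia.
  move=> m /andP[nema]; rewrite -leqNgt leq_eqVlt => /orP[/eqP/val_inj eqma|].
    by rewrite eqma eqxx in nema.
  by move=> /uu->; rewrite mul0r.
split=> [uX a b|XE]; first by rewrite -operator_matrix_mulE -uX uXE addrK.
by apply/matrixP => a b; rewrite uXE XE operator_matrix_mulE subrK.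
Qed.

Section Conjugate.
Variables u X : 'M[F]_n.
Hypotheses (uni : unipotent u) (uX : u *m X = A *m u).

Let uu : upper u := uni.1.
Let u1 : forall i, u i i = 1 := uni.2.
Let XE := (conj_rowP X uni).1 uX.

Lemma conj_upper : upper X.
Proof.
apply: (upper_mulKl uu (unipotent_unitmx uni)); rewrite uX.
exact: upper_mul operator_matrix_upper uu.
Qed.

Lemma conj_diag b : X b b = lam b.
Proof.
have := upper_diag_mul b uu conj_upper.
rewrite uX upper_diag_mul // ?u1 ?mul1r ?mulr1 => [<-|]; last first.
  exact: operator_matrix_upper.
rewrite mxE eqxx; case: (boolP (above b b)) => [/above_lt|_].
  by rewrite ltnn.
by rewrite addr0.
Qed.

(* Above the diagonal and within the diagram of b, the lowest nonzero entry of
   column b of X is a 1 in the row of the box below b. *)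
Lemma conj_block (a b : 'I_n) :
  dg a = dg b -> (a < b)%N -> (forall j, above b j -> j <= a)%N ->
  X a b = (above b a)%:R.
Proof.
have [k] := ubnP (n - a)%N; elim: k a => // k IHk a lta dgab ltab below_b.
have lam_ab : lam a = lam b by apply/eqP; rewrite lam_eq dgab.
rewrite XE.
(* If [b] is not the box above [a], that box comes after [b]: either the box below [b] precedes [a],
   or [b] is in the bottom row. The entry of [u] there is below the diagonal. *)
have -> : \sum_(m | above m a) u m b = (above b a)%:R.
  case: (boolP (above b a)) => ab.
    rewrite (bigD1 b) //= u1 big1 ?addr0 // => m /andP[am].
    by rewrite (above_injr am ab) eqxx.
  rewrite big1 // => m am; apply: uu.
  have [j bj|bot] := pickP (above b).
    rewrite (above_mono bj am) ltn_neqAle below_b // andbT.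
    by apply: contraNneq ab => /val_inj <-.
  by apply: (above_bottom _ am) => [j|]; rewrite ?bot // (above_dg am).
(* Column [b] of [X] vanishes strictly between rows [a] and [b] by induction, and below row [b] by
   triangularity. The diagonal term that remains cancels [lam a * u a b]. *)
have -> : \sum_(m < n | (a < m)%N) u a m * X m b = u a b * lam b.
  rewrite (bigD1 b) //= conj_diag big1 ?addr0 // => m /andP[ltam nemb].
  have [ltmb|ltbm|/val_inj eqmb] := ltngtP m b; last by rewrite eqmb eqxx in nemb.
    have dgmb : dg m = dg b.
      have := dg_homo (ltnW ltam); have := dg_homo (ltnW ltmb); lia.
    rewrite IHk //.
    - case: (boolP (above b m)) => [/below_b|_]; first by rewrite leqNgt ltam.
      by rewrite mulr0.
    - by have := ltn_ord m; lia.
    - by move=> j /below_b; lia.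
  by rewrite conj_upper ?mulr0.
by rewrite lam_ab mulrC addrAC subrr add0r.
Qed.

Lemma conj_above (i j : 'I_n) : above i j -> X j i = 1.
Proof.
move=> ij; rewrite conj_block ?ij //; first by rewrite (above_dg ij).
  exact: above_lt.
by move=> j' /(above_injl ij)->.
Qed.

End Conjugate.

(* In row a of u the entry (a, m) is the one solved for from X a b = 0. *)
Definition pivot_for (a m b : 'I_n) : bool :=
  if dg a == dg m then above b m else b == m.

Definition pivot_coef (a b : 'I_n) : F :=
  if dg a == dg b then -1 else lam a - lam b.

(** The coefficient of [u a m] in the expression of [X a b], for [a < m]; it involves [X] only in
    rows below [a]. *)
Definition row_coef (a : 'I_n) (x : 'I_n -> 'I_n -> F) (m b : 'I_n) : F :=
  lam a *+ (m == b) - x m b.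

Definition pivot_rest (u x : 'I_n -> 'I_n -> F) (a m b : 'I_n) : F :=
  \sum_(l | above l a) u l b + \sum_(l < n | (a < l < m)%N) u a l * row_coef a x l b.

Lemma pivot_for_inj a m b b' : pivot_for a m b -> pivot_for a m b' -> b = b'.
Proof.
rewrite /pivot_for; case: ifP => _; first exact: above_injr.
by move=> /eqP-> /eqP->.
Qed.

Lemma pivot_for_leq a m b : pivot_for a m b -> (m <= b)%N.
Proof.
rewrite /pivot_for; case: ifP => _; last by move=> /eqP->.
by move=> /above_lt/ltnW.
Qed.

Lemma pivot_for_dg a m b : pivot_for a m b -> dg b = dg m.
Proof.
rewrite /pivot_for; case: ifP => _; last by move=> /eqP->.
exact: above_dg.
Qed.

Lemma pivot_coef_neq0 a b : pivot_coef a b != 0.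
Proof.
rewrite /pivot_coef; case: ifP => [_|dgab]; first by rewrite oppr_eq0 oner_neq0.
by rewrite subr_eq0 lam_eq dgab.
Qed.

Lemma conj_pivot (u X : 'M[F]_n) (a m b : 'I_n) :
  unipotent u -> u *m X = A *m u -> (a < m)%N -> pivot_for a m b ->
  X a b = pivot_rest u X a m b + u a m * pivot_coef a b.
Proof.
move=> uni uX ltam piv.
have ltab : (a < b)%N := leq_trans ltam (pivot_for_leq piv).
have Xup := conj_upper uni uX; have Xdiag := conj_diag uni uX.
(* Nothing to the right of the pivot contributes: beyond [b] by triangularity, between [m] and [b]
   by [conj_block], and at [b] itself because the two eigenvalues agree. *)
have coef0 (l : 'I_n) : (m < l)%N -> row_coef a X l b = 0.
  move=> ltml; rewrite /row_coef.
  have [ltbl|ltlb|/val_inj eqlb] := ltngtP b l.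
  - by rewrite Xup // -val_eqE gtn_eqF // subr0.
  - move: (piv); rewrite /pivot_for; case: ifP => [/eqP dgam bm|_ /eqP eqbm].
      have dgb := above_dg bm.
      have dgl : dg l = dg b.
        have := dg_homo (ltnW ltlb); have := dg_homo (ltnW ltml); lia.
      rewrite (conj_block uni uX) // => [|j bj]; last first.
        by rewrite -(above_injl bm bj) ltnW.
      rewrite -val_eqE ltn_eqF // sub0r.
      case: (boolP (above b l)) => [/(above_injl bm) eqml|_]; last by rewrite oppr0.
      by rewrite eqml ltnn in ltml.
    by move: ltlb; rewrite eqbm; lia.
  - move: (piv); rewrite eqlb /row_coef eqxx Xdiag /pivot_for.
    case: ifP => [/eqP dgam bm|_ /eqP eqbm]; last first.
      by move: ltml; rewrite eqbm ltnn.
    by apply/eqP; rewrite subr_eq0 lam_eq dgam (above_dg bm).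
have coefm : row_coef a X m b = pivot_coef a b.
  move: (piv); rewrite /row_coef /pivot_coef (pivot_for_dg piv) /pivot_for.
  case: ifP => [_ bm|_ /eqP->]; last by rewrite eqxx Xdiag.
  rewrite (conj_above uni uX bm) -val_eqE ltn_eqF ?sub0r //.
  exact: above_lt.
rewrite ((conj_rowP X uni).1 uX) /pivot_rest addrAC addrC -addrA; congr (_ + _).
rewrite -coefm.
transitivity (\sum_(l < n | (a < l)%N) u a l * row_coef a X l b).
  rewrite /row_coef; under [RHS]eq_bigr do rewrite mulrBr.
  rewrite sumrB; congr (_ - _).
  rewrite (bigD1 b) //= eqxx big1 ?addr0 => [|l /andP[_ nelb]].
    by rewrite mulr1n mulrC.
  by rewrite (negbTE nelb) mulr0.
rewrite (bigD1 m) //= addrC; congr (_ + _).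
rewrite (bigID (fun l : 'I_n => l < m)%N) /= [X in _ + X]big1 ?addr0.
  by apply: eq_bigl => l; rewrite -val_eqE /=; lia.
move=> l /andP[/andP[_ nelm] lelm]; rewrite coef0 ?mulr0 //.
by move: nelm; rewrite -val_eqE /=; lia.
Qed.

Variables (c : 'S_n) (h : 'I_n -> 'I_n).
Hypothesis h_geq : forall i : 'I_n, (i <= h i)%N.

Definition hessenberg_zeros (X : 'M[F]_n) : Prop :=
  forall a b : 'I_n, (h (c b) < c a)%N -> X a b = 0.

(** If [i] lies above [j], entry (j, i) of [X] is 1 whatever [u] is, so it cannot be one of the
    required zeros. *)
Lemma hessenberg_zeros_permissible (u X : 'M[F]_n) :
  unipotent u -> u *m X = A *m u -> hessenberg_zeros X ->
  forall i j, above i j -> (c j <= h (c i))%N.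
Proof.
move=> uni uX X0 i j ij; rewrite leqNgt; apply/negP => /X0.
by move=> /eqP; rewrite (conj_above uni uX ij) oner_eq0.
Qed.

Hypothesis perm : forall i j, above i j -> (c j <= h (c i))%N.

Definition inversion (a m : 'I_n) : bool := ((a < m) && (c m < c a))%N.

Definition solved_by (a m b : 'I_n) : bool :=
  pivot_for a m b && (h (c b) < c a)%N.

Definition free_entries : {set 'I_n * 'I_n} :=
  [set p | inversion p.1 p.2 && ~~ [exists b, solved_by p.1 p.2 b]].

(** Each required zero above the diagonal either determines its pivot or, when the box below [b]
    precedes [a] or does not exist, holds by [conj_block]; [perm] excludes that this box is [a]. *)
Lemma hessenberg_zerosP (u X : 'M[F]_n) :
  unipotent u -> u *m X = A *m u ->
  hessenberg_zeros X <->
  forall a m b, inversion a m -> solved_by a m b ->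
    u a m = - pivot_rest u X a m b / pivot_coef a b.
Proof.
move=> uni uX; have k0 := pivot_coef_neq0.
have solve (a m b : 'I_n) : (a < m)%N -> pivot_for a m b ->
    X a b = 0 <-> u a m = - pivot_rest u X a m b / pivot_coef a b.
  move=> ltam piv; rewrite (conj_pivot uni uX ltam piv); split=> [/eqP|->].
    by rewrite addr_eq0 => /eqP->; rewrite opprK mulfK.
  by rewrite divfK // subrr.
split=> [X0 a m b /andP[ltam _] /andP[piv /X0]|Hu a b lth].
  by move/(solve _ _ _ ltam piv).
have [ltba|ltab|/val_inj eqab] := ltngtP b a.
- exact: conj_upper uni uX _ _ ltba.
(* From [c m <= h (c b) < c a] the pivot is an inversion, hence a genuine variable. The first
   inequality comes from [perm] within a diagram and from [h_geq] across diagrams. *)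
- have solved (m : 'I_n) : (a < m)%N -> (c m <= h (c b))%N -> pivot_for a m b -> X a b = 0.
    move=> ltam lem piv; apply/(solve a m b) => //.
    by apply: Hu; rewrite /inversion /solved_by ?piv ?ltam //=;
       apply: leq_ltn_trans lem lth.
  have [dgab|nedg] := eqVneq (dg a) (dg b); last first.
    by apply: (solved b) => //; rewrite /pivot_for (negbTE nedg).
  have notab : ~~ above b a by apply/negP => /perm; rewrite leqNgt lth.
  have [m bm|bot] := pickP (above b); last first.
    rewrite (conj_block uni uX) ?(negbTE notab) // => j.
    by rewrite bot.
  have [ltam|ltma|/val_inj eqam] := ltngtP a m.
  + apply: (solved m) => //; first exact: perm.
    by rewrite /pivot_for dgab (above_dg bm) eqxx.
  + rewrite (conj_block uni uX) ?(negbTE notab) // => j bj.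
    by rewrite -(above_injl bm bj) ltnW.
  + by rewrite eqam bm in notab.
- by move: lth; rewrite eqab ltnNge h_geq.
Qed.

(** A joint recursion for [u] (tag [false]) and its conjugate [X] (tag [true]), with [w] prescribing
    the free entries. *)
Definition solution_step (w : 'I_n * 'I_n -> F)
    (v : bool * 'I_n * 'I_n -> F) (x : bool * 'I_n * 'I_n) : F :=
  let u i j := v (false, i, j) in let y i j := v (true, i, j) in
  let: (s, a, b) := x in
  if s then
    lam a * u a b + \sum_(m | above m a) u m b
      - \sum_(m < n | (a < m)%N) u a m * y m b
  else if inversion a b then
    if [pick k | solved_by a b k] is Some k
    then - pivot_rest u y a b k / pivot_coef a k
    else w (a, b)
  else (a == b)%:R.

(** Lexicographic: rows from the bottom up and, within a row, the entries of [u] from left to right,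
    then those of [X]. The second component is at most [n], hence the factor [n.+1]. *)
Definition solution_rank (x : bool * 'I_n * 'I_n) : nat :=
  (n - x.1.2) * n.+1 + (if x.1.1 then n : nat else x.2).

Lemma solution_step_local w f g x :
  (forall y, (solution_rank y < solution_rank x)%N -> f y = g y) ->
  solution_step w f x = solution_step w g x.
Proof.
case: x => [[s a] b] fg.
have lower s' (l j : 'I_n) : (a < l)%N -> f (s', l, j) = g (s', l, j).
  move=> ltal; apply: fg; rewrite /solution_rank /=.
  have := ltn_ord l; have := ltn_ord a; have := ltn_ord j; have := ltn_ord b.
  by case: s; case: s' => /=; nia.
case: s fg => /= fg.
  have row j : f (false, a, j) = g (false, a, j).
    by apply: fg; rewrite /solution_rank /= ltn_add2l.
  rewrite row; congr (_ + _ - _).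
    by apply: eq_bigr => m /above_lt am; rewrite lower.
  by apply: eq_bigr => m am; rewrite row lower.
case: ifP => // _; case: pickP => [k _|//].
rewrite /pivot_rest /row_coef; congr (- (_ + _) / _).
  by apply: eq_bigr => l /above_lt am; rewrite lower.
apply: eq_bigr => l /andP[ltal ltlb]; rewrite (lower true) //; congr (_ * _).
by apply: fg; rewrite /solution_rank /= ltn_add2l.
Qed.

Definition solution_entry w := local_fix solution_rank (solution_step w).

Definition solution w : 'M[F]_n := \matrix_(i, j) solution_entry w (false, i, j).

Lemma solutionP w (u := solution w) (X := invmx u *m A *m u) :
  [/\ normal_form c u, hessenberg_zeros X
    & {in free_entries, forall p, u p.1 p.2 = w p}].
Proof.
have fixE := local_fixE (@solution_step_local w).
rewrite -/(solution_entry w) in fixE.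
pose Y : 'M[F]_n := \matrix_(i, j) solution_entry w (true, i, j).
have uE i j : solution_entry w (false, i, j) = u i j by rewrite mxE.
have YE i j : solution_entry w (true, i, j) = Y i j by rewrite mxE.
have nu : normal_form c u.
  by move=> i j /negbTE nij; rewrite mxE -fixE /= /inversion nij.
have uni := normal_form_unipotent nu.
have uY : u *m Y = A *m u.
  apply/conj_rowP => // a b; rewrite -YE -fixE /= uE.
  congr (_ + _ - _); first by apply: eq_bigr => m _; rewrite uE.
  by apply: eq_bigr => m _; rewrite uE YE.
(* The matrix built by the recursion is thus the true conjugate, so the pivot equations express its
   zeros. *)
have XY : X = Y by rewrite /X -mulmxA -uY mulKmx // unipotent_unitmx.
have restE a m b : pivot_rest u Y a m b =
    pivot_rest (fun i j => solution_entry w (false, i, j))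
               (fun i j => solution_entry w (true, i, j)) a m b.
  by rewrite /pivot_rest /row_coef; congr (_ + _);
     apply: eq_bigr => l _; rewrite uE ?YE.
split=> //.
  rewrite XY; apply/(hessenberg_zerosP uni uY) => a m b inv_am sol.
  rewrite -uE -fixE /= inv_am; case: pickP => [k sol'|/(_ b)]; last by rewrite sol.
  case/andP: sol => piv _; case/andP: sol' => piv' _.
  by rewrite (pivot_for_inj piv piv') restE.
move=> [a m]; rewrite inE /= => /andP[inv_am /existsPn nsol].
rewrite -uE -fixE /= inv_am; case: pickP => // k.
by rewrite (negbTE (nsol k)).
Qed.

(** Such a [u] and its conjugate form a fixed point of [solution_step], and that fixed point is
    unique. *)
Lemma solution_unique w (u : 'M[F]_n) :
  normal_form c u -> hessenberg_zeros (invmx u *m A *m u) ->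
  {in free_entries, forall p, u p.1 p.2 = w p} -> u = solution w.
Proof.
move=> nu X0 uw; set X := _ *m u in X0.
have uni := normal_form_unipotent nu.
have uX : u *m X = A *m u by rewrite /X mulmxA mulKVmx // unipotent_unitmx.
pose v (x : bool * 'I_n * 'I_n) :=
  let: (s, i, j) := x in if s then X i j else u i j.
suff fixv : solution_step w v =1 v.
  apply/matrixP => i j; rewrite mxE /solution_entry.
  by rewrite -(local_fix_unique (@solution_step_local w) fixv).
case=> [[[] a] b] /=; first by apply/esym; rewrite ((conj_rowP X uni).1 uX).
case: ifP => [inv_ab|/negbT/nu-> //].
case: pickP => [k sol|nsol].
  by apply/esym/((hessenberg_zerosP uni uX).1 X0).
apply/esym/(uw (a, b)); rewrite inE /= inv_ab; apply/existsPn => k.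
by rewrite nsol.
Qed.

(** A round of the recursion only adds, multiplies and divides by constants [pivot_coef]. *)
Lemma solution_rational d (w : 'rV[F]_d -> 'I_n * 'I_n -> F) X :
  (forall p, rational_on X (fun y => w y p)) ->
  forall i j, rational_on X (fun y => solution (w y) i j).
Proof.
move=> ratw i j.
apply: (@rational_on_ext _ _ _
  (fun y => solution_entry (w y) (false, i, j))).
  by move=> y _; rewrite mxE.
rewrite /solution_entry /local_fix; move: (\max_x _).+1 (false, i, j) => k.
elim: k => [|k ratv] x /=; first exact: rational_on_cst.
case: x => [[[] a] b] /=.
  apply: rational_on_add.
    apply: rational_on_add; last by apply: rational_on_sum => m _; exact: ratv.
    by apply: rational_on_mul; [exact: rational_on_cst | exact: ratv].
  apply: rational_on_opp; apply: rational_on_sum => m _.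
  by apply: rational_on_mul; exact: ratv.
case: (inversion a b); last exact: rational_on_cst.
case: [pick k | solved_by a b k] => [m|]; last exact: ratw.
apply: rational_on_mul; last exact: rational_on_cst.
apply: rational_on_opp; apply: rational_on_add.
  by apply: rational_on_sum => l _; exact: ratv.
apply: rational_on_sum => l _; apply: rational_on_mul; first exact: ratv.
by apply: rational_on_add; [exact: rational_on_cst | exact: rational_on_opp (ratv _)].
Qed.

(** Within a diagram, the only equation that can solve for (a, m) belongs to the box above [m];
    across diagrams it belongs to [m] itself. Negating [solved_by] gives the two counted
    conditions. *)
Lemma card_free_entries :
  #|free_entries| =
  (#|[set p : 'I_n * 'I_n | [&& dg p.1 == dg p.2, (p.1 < p.2)%N,
        (c p.2 < c p.1)%N
      & [forall k, above k p.2 ==> (c p.1 <= h (c k))%N]]]%SET|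
   + #|[set p : 'I_n * 'I_n | [&& (dg p.1 < dg p.2)%N, (c p.1 <= h (c p.2))%N
      & (c p.2 < c p.1)%N]]%SET|)%N.
Proof.
set S1 := [set p | _]%SET; set S2 := [set p | _]%SET.
rewrite -cardsUI [S1 :&: S2](_ : _ = finset.set0) ?cards0 ?addn0; last first.
  apply/setP => p; rewrite !inE; case: eqP => //= ->; rewrite ltnn andbF //.
congr #|pred_of_set _|; apply/setP => -[a m]; rewrite !inE /= /inversion.
have dg_lt : dg a != dg m -> (dg a < dg m)%N = (a < m)%N.
  move=> nedg; have [ltam|lema] := ltnP a m; last first.
    by apply/negbTE; rewrite -leqNgt dg_homo.
  by rewrite ltn_neqAle nedg dg_homo // ltnW.
have [dgam|nedg] := eqVneq (dg a) (dg m).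
  rewrite dgam ltnn orbF /= -andbA; congr [&& _, _ & _].
  rewrite negb_exists; apply: eq_forallb => k.
  by rewrite /solved_by /pivot_for dgam eqxx negb_and -leqNgt implybE.
have -> : ~~ [exists b, solved_by a m b] = (c a <= h (c m))%N.
  rewrite negb_exists; apply/forallP/idP => [/(_ m)|le k].
    by rewrite /solved_by /pivot_for (negbTE nedg) eqxx -leqNgt.
  rewrite /solved_by /pivot_for (negbTE nedg).
  by case: eqP => //= ->; rewrite -leqNgt.
by rewrite dg_lt //= -andbA; congr (_ && _); rewrite andbC.
Qed.

End RowReduction.

(** * Flags and Hessenberg spaces *)

Section Flags.
Variables (F : fieldType) (n : nat) (P : 'M[F]_n).
Hypothesis P1 : P \in unitmx.
Implicit Types x y b : 'M[F]_n.

Lemma operator_ofK : cancel (operator_of P) (matrix_of P).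
Proof.
by move=> x; rewrite /matrix_of /operator_of -!mulmxA mulKmx // mulVmx // mulmx1.
Qed.

Lemma matrix_ofK : cancel (matrix_of P) (operator_of P).
Proof.
by move=> x; rewrite /matrix_of /operator_of !mulmxA mulmxV // mul1mx mulmxK.
Qed.

Lemma operator_ofM x y :
  operator_of P (x *m y) = operator_of P x *m operator_of P y.
Proof. by rewrite /operator_of !mulmxA mulmxKV. Qed.

Lemma operator_of_unit x : (operator_of P x \in unitmx) = (x \in unitmx).
Proof. by rewrite !unitmx_mul unitmx_inv P1 andbT. Qed.

Lemma operator_ofV x : x \in unitmx ->
  operator_of P (invmx x) = invmx (operator_of P x).
Proof.
move=> x1; have o1 : operator_of P x \in unitmx by rewrite operator_of_unit.
apply: (can_inj (mulKmx o1)).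
by rewrite mulmxV // -operator_ofM mulmxV // /operator_of mulmx1 mulmxV.
Qed.

Lemma borelP b : borel P (operator_of P b) <-> b \in unitmx /\ upper b.
Proof.
by split=> -[b1 bu]; split; rewrite /= ?operator_of_unit // in b1 *; move=> i j;
   have := bu i j; rewrite operator_ofK.
Qed.

Lemma flag_eqP x y :
  flag P (operator_of P x) = flag P (operator_of P y) <->
  exists b, [/\ upper b, b \in unitmx & x = y *m b].
Proof.
split=> [xy|[b [ub b1 ->]]].
  have : flag P (operator_of P y) (operator_of P x).
    rewrite -xy; exists (operator_of P 1%:M); last by rewrite -operator_ofM mulmx1.
    by apply/borelP; split; [exact: unitmx1 | exact: upper1].
  case=> g Bg; rewrite -(matrix_ofK g) in Bg *; move/borelP: Bg => [b1 bu].
  rewrite -operator_ofM => /(can_inj operator_ofK) yx.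
  by exists (matrix_of P g).
apply/seteqP; split=> _ [g Bg <-]; rewrite -(matrix_ofK g) in Bg *;
  move/borelP: Bg; set a := matrix_of P g => -[a1 au].
  exists (operator_of P (b *m a)); last by rewrite -!operator_ofM mulmxA.
  by apply/borelP; rewrite unitmx_mul b1; split=> //; exact: upper_mul.
exists (operator_of P (invmx b *m a)).
  apply/borelP; rewrite unitmx_mul unitmx_inv b1; split=> //.
  exact: upper_mul (upper_inv ub b1) au.
by rewrite -!operator_ofM mulmxA mulmxK.
Qed.

Variables (H : {vspace 'M[F]_n}) (h : 'I_n -> 'I_n).
Hypotheses (H_hess : hessenberg_space P H) (h_hess : hessenberg_function h)
  (Hh : corresponding_function P H h).

Lemma hessenberg_function_homo (i j : 'I_n) : (i <= j)%N -> (h i <= h j)%N.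
Proof.
case: h_hess => _ hS.
have [k] := ubnP (j - i)%N; elim: k j => // k IHk j ltk.
rewrite leq_eqVlt => /orP[/eqP/val_inj-> //|ltij].
have lt_pred : (j.-1 < n)%N by have := ltn_ord j; lia.
apply: (@leq_trans (h (Ordinal lt_pred))); last by apply: hS => /=; lia.
by apply: IHk => /=; lia.
Qed.

Definition hessenberg_shape x : Prop :=
  forall i j : 'I_n, (h j < i)%N -> x i j = 0.

(** The correspondence [Hh] tests matrix units only. Stability under brackets with diagonal matrix
    units shows that [H] is spanned by the matrix units it contains. *)
Lemma mem_hessenbergP x : operator_of P x \in H <-> hessenberg_shape x.
Proof.
have opZ a y : operator_of P (a *: y) = a *: operator_of P y.
  by rewrite /operator_of -scalemxAr -scalemxAl.
have opB y z : operator_of P (y - z) = operator_of P y - operator_of P z.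
  by rewrite /operator_of mulmxBr mulmxBl.
case: H_hess => bH adH; case: h_hess => h_geq _.
have borel_delta (i j : 'I_n) : (i <= j)%N ->
    borel_algebra P (operator_of P (delta_mx i j)).
  move=> leij k l ltlk; rewrite operator_ofK mxE.
  by case: eqP => //= eqki; case: eqP => //= eqlj; move: ltlk leij; rewrite eqki eqlj; lia.
split=> [xH i j lthi|x0]; last first.
  rewrite (matrix_sum_delta x) /operator_of mulmx_sumr mulmx_suml.
  apply: memv_suml => i _; rewrite mulmx_sumr mulmx_suml.
  apply: memv_suml => j _; rewrite -/(operator_of P _) opZ.
  have [leih|ltih] := leqP i (h j); first by apply/memvZ/Hh.
  by rewrite x0 // scale0r mem0v.
have ltji : (j < i)%N := leq_ltn_trans (h_geq j) lthi.
apply/eqP; apply: contraTT lthi => xij; rewrite -leqNgt; apply/Hh.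
(* Bracketing with E_ii, then with E_jj, isolates the entries (i, j) and
   (j, i); the second one is in b. *)
have delta_mul (k l : 'I_n) : delta_mx k k *m x *m delta_mx l l = x k l *: delta_mx k l.
  apply/matrixP => a b; rewrite mxE (bigD1 l) //= big1 => [|m neml]; last first.
    by rewrite [delta_mx l l _ _]mxE (negbTE neml) mulr0.
  rewrite addr0 !mxE eqxx /= (bigD1 k) //= big1 => [|m nemk]; last first.
    by rewrite mxE (negbTE nemk) andbF mul0r.
  by rewrite addr0 mxE eqxx andbT; case: (a == k); case: (b == l);
     rewrite /= ?mulr1 ?mulr0 ?mul1r ?mul0r ?mulr0.
have delta0 : delta_mx j j *m delta_mx i i = 0 :> 'M[F]_n.
  by rewrite mul_delta_mx_0 // -val_eqE ltn_eqF.
have delta0' : delta_mx i i *m delta_mx j j = 0 :> 'M[F]_n.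
  by rewrite mul_delta_mx_0 // -val_eqE gtn_eqF.
have := adH _ _ (borel_delta j j (leqnn _)) (adH _ _ (borel_delta i i (leqnn _)) xH).
rewrite -!operator_ofM -!opB -!operator_ofM -opB.
rewrite mulmxBr mulmxBl !mulmxA delta0 mul0mx sub0r.
rewrite -[X in - _ - (_ - X)]mulmxA delta0' mulmx0 subr0 !delta_mul.
rewrite -opprD -scaleN1r opZ scaleN1r rpredN.
rewrite /operator_of mulmxDr mulmxDl -!/(operator_of P _) !opZ.
have ji_H : x j i *: operator_of P (delta_mx j i) \in H.
  by apply/memvZ/bH/borel_delta; exact: ltnW.
by rewrite (rpredDl _ ji_H) rpredZeq (negbTE xij).
Qed.

(** Only entries (l, k) of [x] with [l >= i] and [k <= j] reach position (i, j), and [h] is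
    monotone. *)
Lemma hessenberg_shape_conj b x :
  upper b -> b \in unitmx -> hessenberg_shape x ->
  hessenberg_shape (invmx b *m x *m b).
Proof.
move=> ub b1 x0 i j lthi; rewrite mxE big1 // => k _.
have [ltjk|lekj] := ltnP j k; first by rewrite ub ?mulr0.
rewrite mxE big1 ?mul0r // => l _.
have [ltli|leil] := ltnP l i; first by rewrite upper_inv ?mul0r.
rewrite x0 ?mulr0 //; apply: leq_ltn_trans (hessenberg_function_homo lekj) _.
exact: leq_trans lthi leil.
Qed.

Variable M : 'M[F]_n.
Notation A := (matrix_of P M).

Lemma hessenberg_varietyP x : x \in unitmx ->
  hessenberg_variety M P H (flag P (operator_of P x)) <->
  hessenberg_shape (invmx x *m A *m x).
Proof.
move=> x1.
have shapeE y : y \in unitmx -> hessenberg_shape (invmx y *m A *m y) <->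
    invmx (operator_of P y) *m M *m operator_of P y \in H.
  move=> y1; rewrite -mem_hessenbergP 2!operator_ofM operator_ofV // matrix_ofK.
  by split.
split=> [[g [g1 gH]]|/(shapeE _ x1) xH]; last first.
  by exists (operator_of P x) => //; split; rewrite ?operator_of_unit.
rewrite -(matrix_ofK g) in g1 gH *.
rewrite operator_of_unit in g1; move/(shapeE _ g1): gH => gH.
move=> /esym/flag_eqP [b [ub b1 ->]].
rewrite invmx_mul //.
have := hessenberg_shape_conj ub b1 gH.
by rewrite !mulmxA.
Qed.

(** The ones of [perm_mx s] are at (i, s i), those of the operator at (pi j, j); hence the
    inverse. *)
Lemma perm_operatorE (pi : 'S_n) :
  perm_operator P pi = operator_of P (perm_mx pi^-1).
Proof.
congr (operator_of P _); apply/matrixP => i j; rewrite !mxE.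
by congr (_%:R); rewrite (can2_eq (permKV pi) (permK pi)).
Qed.

Lemma hessenberg_cellP (c : 'S_n) X :
  hessenberg_cell M P H c^-1 X <->
  exists u, [/\ normal_form c u, hessenberg_zeros c h (invmx u *m A *m u)
    & X = flag P (operator_of P (u *m perm_mx c))].
Proof.
have W1 := unitmx_perm F c.
have zerosE u : normal_form c u ->
    hessenberg_variety M P H (flag P (operator_of P (u *m perm_mx c))) <->
    hessenberg_zeros c h (invmx u *m A *m u).
  move=> nu; have u1 := unipotent_unitmx (normal_form_unipotent nu).
  rewrite hessenberg_varietyP ?unitmx_mul ?u1 // invmx_mul //.
  have -> : invmx (perm_mx c) *m invmx u *m A *m (u *m perm_mx c) =
      invmx (perm_mx c) *m (invmx u *m A *m u) *m perm_mx c.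
    by rewrite !mulmxA.
  split=> [x0 a b lth|x0 i j lth]; first by rewrite -(conj_perm_mxE c) x0.
  by rewrite -(permKV c i) -(permKV c j) conj_perm_mxE x0 ?permKV.
split=> [[[g Bg <-]]|[u [nu u0 ->]]]; last first.
  have uni := normal_form_unipotent nu.
  split; last exact/zerosE.
  exists (operator_of P u); last by rewrite perm_operatorE invgK operator_ofM.
  by apply/borelP; split; [exact: unipotent_unitmx | case: uni].
rewrite perm_operatorE invgK.
rewrite -(matrix_ofK g) in Bg *; case/borelP: Bg => b1 ub.
rewrite -operator_ofM; have [u [t [nu -> ut t1 ct]]] := bruhat_factor c ub b1.
have -> : flag P (operator_of P (u *m t *m perm_mx c)) =
          flag P (operator_of P (u *m perm_mx c)).
  apply/flag_eqP; exists (invmx (perm_mx c) *m t *m perm_mx c); split.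
  - exact: upper_perm_conj.
  - by rewrite !unitmx_mul unitmx_inv W1 t1.
  - by rewrite !mulmxA mulmxK.
by move=> /(zerosE _ nu) u0; exists u.
Qed.

(** Comparing two representatives of a common flag, a nonzero diagonal entry of an upper triangular
    matrix reappears in another one at position (pi^-1 i, pi'^-1 i), which therefore is not below
    the diagonal. *)
Lemma schubert_cell_leq (pi pi' : 'S_n) X (i : 'I_n) :
  schubert_cell P pi X -> schubert_cell P pi' X -> (pi^-1 i <= pi'^-1 i)%g%N.
Proof.
case=> [g Bg <-] [g' Bg']; rewrite !perm_operatorE.
rewrite -(matrix_ofK g) -(matrix_ofK g') in Bg Bg' *.
move: Bg Bg' => /borelP[b1 ub] /borelP[b1' ub'].
rewrite -!operator_ofM => /flag_eqP[t [ut _ bW]].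
move: (matrix_of P g) (matrix_of P g') b1 ub b1' ub' bW => b b' b1 ub b1' ub' bW.
have {}bW : invmx b *m b' *m perm_mx pi'^-1 = perm_mx pi^-1 *m t.
  by rewrite -mulmxA bW !mulmxA mulVmx // mul1mx.
have ub'' := upper_mul (upper_inv ub b1) ub'.
have : (invmx b *m b') i i != 0.
  have : invmx b *m b' \in unitmx by rewrite unitmx_mul unitmx_inv b1.
  by rewrite upper_unitmx // => /forallP.
rewrite leqNgt; apply: contraNN => lti; rewrite -(ut _ _ lti).
move/matrixP: bW => /(_ i (pi'^-1 i)%g).
by rewrite -col_permE -row_permE mxE permKV [RHS]mxE => ->.
Qed.

Lemma schubert_cell_inj (pi pi' : 'S_n) X :
  schubert_cell P pi X -> schubert_cell P pi' X -> pi = pi'.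
Proof.
move=> piX pi'X; apply: invg_inj; apply/permP => i; apply/val_inj/eqP.
by rewrite eqn_leq (schubert_cell_leq _ piX pi'X) (schubert_cell_leq _ pi'X piX).
Qed.

End Flags.

(** * Cells of the Hessenberg variety *)

Section Cells.
Variables (F : fieldType) (n : nat) (M P : 'M[F]_n).
Variables (H : {vspace 'M[F]_n}) (h : 'I_n -> 'I_n).
Variables (dg : 'I_n -> nat) (lam : 'I_n -> F) (above : rel 'I_n).
Hypothesis P1 : P \in unitmx.
Hypotheses (H_hess : hessenberg_space P H) (h_hess : hessenberg_function h)
  (Hh : corresponding_function P H h).
Hypothesis dg_homo : forall i j : 'I_n, (i <= j)%N -> (dg i <= dg j)%N.
Hypothesis lam_eq : forall i j : 'I_n, (lam i == lam j) = (dg i == dg j).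
Hypothesis above_dg : forall k j : 'I_n, above k j -> dg k = dg j.
Hypothesis above_lt : forall k j : 'I_n, above k j -> (j < k)%N.
Hypothesis above_mono : forall k j k' j' : 'I_n,
  above k j -> above k' j' -> (k < k')%N = (j < j')%N.
Hypothesis above_bottom : forall k l j : 'I_n,
  (forall j', ~~ above k j') -> above l j -> dg l = dg k -> (k < l)%N.
Hypothesis matrix_ofM : matrix_of P M = operator_matrix lam above.

Let cellP := hessenberg_cellP P1 H_hess h_hess Hh M.

Lemma cell_nonempty (c : 'S_n) :
  hessenberg_cell M P H c^-1 !=set0 <->
  forall i j, above i j -> (c j <= h (c i))%N.
Proof.
split=> [[X /cellP[u [nu u0 _]]]|perm]; last first.
  (* The witness is the point whose free entries are all zero. *)
  have [nu u0 _] := solutionP dg_homo lam_eq above_dg above_lt above_mono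
    above_bottom h_hess.1 perm (fun=> 0).
  by eexists; apply/cellP; eexists; split; [exact: nu | rewrite matrix_ofM | ].
have uni := normal_form_unipotent nu.
apply: (hessenberg_zeros_permissible dg_homo lam_eq above_dg above_lt above_mono
  above_bottom uni _ u0).
by rewrite matrix_ofM !mulmxA mulmxV ?mul1mx // unipotent_unitmx.
Qed.

Section Cell.
Variable c : 'S_n.
Hypothesis perm : forall i j, above i j -> (c j <= h (c i))%N.

Notation free := (free_entries dg above c h).
Notation cell := (hessenberg_cell M P H c^-1).
Notation sol := (solution dg lam above c h).

(** Extension by zero outside the free entries, written as a linear form in [v] so that rationality
    is immediate. *)
Definition free_coordinates (v : 'rV[F]_#|free|) (p : 'I_n * 'I_n) : F :=
  \sum_k v 0 k * (enum_val k == p)%:R.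

Lemma free_coordinatesE v k : free_coordinates v (enum_val k) = v 0 k.
Proof.
rewrite /free_coordinates (bigD1 k) //= eqxx mulr1 big1 ?addr0 // => l nelk.
by rewrite (inj_eq enum_val_inj) (negbTE nelk) mulr0.
Qed.

Lemma free_coordinates_rational X p :
  rational_on X (fun v => free_coordinates v p).
Proof.
apply: rational_on_sum => k _.
exact: rational_on_mul (rational_on_coord _ _) (rational_on_cst _ _).
Qed.

Lemma cell_affine : affine_cell_of_dim P cell #|free|.
Proof.
have W1 := unitmx_perm F c.
have solP := solutionP dg_homo lam_eq above_dg above_lt above_mono above_bottom
  h_hess.1 perm.
have sol_unique := solution_unique dg_homo lam_eq above_dg above_lt above_mono
  above_bottom h_hess.1 perm.
pose f v := flag P (operator_of P (sol (free_coordinates v) *m perm_mx c)).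
(* The inverse map reads off the free entries of a normal form, chosen classically; its regularity
   is recovered below from its uniqueness as an LU factor. *)
have /choice[U UP] X : exists u, cell X -> [/\ normal_form c u,
    hessenberg_zeros c h (invmx u *m operator_matrix lam above *m u)
    & X = flag P (operator_of P (u *m perm_mx c))].
  have [/cellP[u]|nX] := pselect (cell X); last by exists 0.
  by rewrite matrix_ofM; exists u.
pose g X : 'rV[F]_#|free| :=
  \row_k U X (enum_val k : 'I_n * 'I_n).1 (enum_val k : 'I_n * 'I_n).2.
have cell_f v : cell (f v).
  have [nu u0 _] := solP (free_coordinates v).
  by apply/cellP; exists (sol (free_coordinates v)); split=> //; rewrite matrix_ofM.
have U_f v : U (f v) = sol (free_coordinates v).
  have [nu _ fE] := UP _ (cell_f v); have [nu' _ _] := solP (free_coordinates v).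
  have [b [ub _ bE]] := (flag_eqP P1 _ _).1 fE.
  exact/esym/(normal_form_unique nu' nu ub bE).
exists f, g; split.
- move=> v; exists 1, (fun v => operator_of P (sol (free_coordinates v) *m perm_mx c)).
  split; first by rewrite meval1 oner_neq0.
    apply: regular_mapP => k; case/mxvec_indexP: k => i j.
    apply: (@rational_on_ext _ _ _ (fun v =>
        operator_of P (sol (free_coordinates v) *m perm_mx c) i j)).
      by move=> y _; rewrite mxvecE.
    apply: rational_on_mulmx i j => i j; last exact: rational_on_cst.
    apply: rational_on_mulmx i j => i j; first exact: rational_on_cst.
    apply: rational_on_mulmx i j => i j; last exact: rational_on_cst.
    by apply: solution_rational => p; exact: free_coordinates_rational.
  move=> w _; split=> //; rewrite operator_of_unit // unitmx_mul W1 andbT.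
  apply: unipotent_unitmx; apply: (@normal_form_unipotent _ _ c).
  by have [] := solP (free_coordinates w).
- apply: regular_mapP => k; set X := (X in rational_on X).
  pose u y := U (flag P (vec_mx y)).
  (* A representative has matrix [u W b] with [W] the permutation matrix. Multiplying by the inverse
     of [W] gives [L b], with [L] lower unipotent and [b] upper triangular, so [lu_rational]
     applies. *)
  pose L y := invmx (perm_mx c) *m u y *m perm_mx c.
  pose A y := invmx (perm_mx c) *m matrix_of P (vec_mx y).
  have XE y : X y -> vec_mx y \in unitmx /\ cell (flag P (vec_mx y)).
    by case=> x xX <-; rewrite mxvecK.
  have uP y : X y -> normal_form c (u y) /\ exists b, [/\ upper b, b \in unitmx
      & matrix_of P (vec_mx y) = u y *m perm_mx c *m b].
    move=> /XE[_ /UP[nu _ yE]]; split=> //; apply/(flag_eqP P1).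
    by rewrite matrix_ofK.
  have L_lower y : X y -> unipotent (L y)^T.
    by move=> /uP[nu _]; exact: normal_form_conj_unipotent.
  have L1 y : X y -> L y \in unitmx.
    by move=> /L_lower/unipotent_unitmx; rewrite unitmx_tr.
  have LA y : X y -> upper (invmx (L y) *m A y) /\ invmx (L y) *m A y \in unitmx.
    move=> Xy; have [nu [b [ub b1 bE]]] := uP y Xy.
    suff -> : invmx (L y) *m A y = b by [].
    apply: (can_inj (mulKmx (L1 y Xy))); rewrite mulKVmx ?L1 //.
    by rewrite /A /L bE !mulmxA.
  have L_rat := lu_rational L_lower LA.
  pose p : 'I_n * 'I_n := enum_val k.
  apply: (@rational_on_ext _ _ _ (fun y => L y (c p.1) (c p.2))).
    by move=> y _; rewrite /L conj_perm_mxE mxE.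
  apply: L_rat => [y Xy|]; first by rewrite mulKVmx ?L1.
  apply: rational_on_mulmx => i j; first exact: rational_on_cst.
  apply: rational_on_mulmx i j => i j; last exact: rational_on_cst.
  apply: rational_on_mulmx i j => i j; first exact: rational_on_cst.
  apply: rational_on_ext (rational_on_coord _ (mxvec_index i j)) => y _.
  by rewrite mxE.
- move=> v; split=> //; apply/rowP => k; rewrite mxE U_f.
  have [_ _ ->] := solP (free_coordinates v); last exact: enum_valP.
  by rewrite free_coordinatesE.
- move=> X cellX; have [nu u0 XE] := UP X cellX.
  rewrite [RHS]XE /f; congr (flag P (operator_of P (_ *m _))).
  apply/esym/sol_unique => // p p_free.
  by rewrite -(enum_rankK_in p_free p_free) free_coordinatesE mxE.
Qed.

End Cell.
End Cells.

(** * The operator in an adapted basis *)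

Section AdaptedBasis.
Variables (F : fieldType) (n : nat) (M : 'M[F]_n) (Y : multidiagram F).
Hypothesis Y_of_M : is_multidiagram M Y.

Lemma multidiagram_size : size (boxes Y) = n.
Proof.
case: Y_of_M => _ Ysorted _ [e _]; rewrite size_boxes //.
by apply: sub_all Ysorted => d /and3P[].
Qed.

Let le_n : (n <= size (boxes Y))%N.
Proof. by rewrite multidiagram_size. Qed.

Lemma eigenvalue_at_eq (i j : 'I_n) :
  (eigenvalue_at Y i == eigenvalue_at Y j) = (diagram_of Y i == diagram_of Y j).
Proof.
have lt_Y (k : 'I_n) : (diagram_of Y k < size Y)%N.
  have /mem_nth : (k < size (boxes Y))%N by exact: leq_trans le_n.
  by move=> /(_ (Box 0 0 0)); rewrite mem_boxes => /and3P[].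
have [Yuniq _ _ _] := Y_of_M.
rewrite /eigenvalue_at -!(nth_map _ 0 (fun d : F * seq nat => d.1)) ?lt_Y //.
by rewrite nth_uniq ?size_map ?lt_Y.
Qed.

Lemma adapted_basis_matrix (P : 'M[F]_n) :
  adapted_basis M Y P ->
  matrix_of P M = operator_matrix (fun i : 'I_n => eigenvalue_at Y i)
                    (fun k j : 'I_n => directly_above Y k j).
Proof.
case=> P1 _ Pabove Pbottom; set A := operator_matrix _ _.
suff MP : M *m P = P *m A by rewrite /matrix_of -mulmxA MP mulKmx.
apply/matrixP => a b.
have -> : (P *m A) a b =
    eigenvalue_at Y b * P a b + \sum_(j < n | directly_above Y b j) P a j.
  rewrite mxE; under eq_bigr do rewrite mxE mulrDr.
  rewrite big_split /=; congr (_ + _).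
    rewrite (bigD1 b) //= eqxx big1 ?addr0 1?mulrC // => j nejb.
    by rewrite (negbTE nejb) mulr0.
  rewrite [RHS]big_mkcond; apply: eq_bigr => j _.
  by case: directly_above; rewrite ?mulr1 ?mulr0.
have -> : (M *m P) a b = (M *m col b P) a 0.
  by rewrite !mxE; apply: eq_bigr => j _; rewrite mxE.
have [j bj|bot] := pickP (fun j : 'I_n => directly_above Y b j).
  rewrite (Pabove _ _ bj) (bigD1 j) //= big1 ?addr0 => [|l /andP[bl nelj]].
    by rewrite !mxE.
  have jl := above_injl (directly_above_mono le_n) bj bl.
  by rewrite jl eqxx in nelj.
rewrite Pbottom => [|j]; last by rewrite bot.
by rewrite big_pred0 // addr0 !mxE.
Qed.

End AdaptedBasis.

(** * Permissible fillings, nonempty cells and their dimensions *)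

Theorem theorem26 (R : realType) (n : nat) (M : 'M[R[i]]_n)
    (Y : multidiagram R[i]) (P : 'M[R[i]]_n)
    (H : {vspace 'M[R[i]]_n}) (h : 'I_n -> 'I_n) :
  is_multidiagram M Y ->
  adapted_basis M Y P ->
  hessenberg_space P H ->
  hessenberg_function h ->
  corresponding_function P H h ->
  set_bij [set c : 'S_n | permissible Y h c]
    [set X | X !=set0 /\ exists pi : 'S_n, X = hessenberg_cell M P H pi]
    (fun c : 'S_n => hessenberg_cell M P H (c^-1)%g) /\
  forall pi : 'S_n, permissible Y h (pi^-1)%g ->
    affine_cell_of_dim P (hessenberg_cell M P H pi)
      (#|same_diagram_pairs Y h (pi^-1)%g|
         + #|different_diagram_pairs Y h (pi^-1)%g|)%N.
Proof.
move=> Y_of_M Y_P H_hess h_hess Hh.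
have P1 : P \in unitmx by case: Y_P.
have le_n : (n <= size (boxes Y))%N by rewrite (multidiagram_size Y_of_M).
have dg_homo := @diagram_of_homo _ Y n le_n.
have lam_eq := eigenvalue_at_eq Y_of_M.
have above_dg := @directly_above_diagram _ Y n.
have above_lt := @directly_above_lt _ Y n le_n.
have above_mono := @directly_above_mono _ Y n le_n.
have above_bottom := @bottom_lt _ Y n le_n.
have ofM := adapted_basis_matrix Y_of_M Y_P.
have cell0 := cell_nonempty P1 H_hess h_hess Hh dg_homo lam_eq above_dg above_lt
  above_mono above_bottom ofM.
split; first split.
- by move=> c /cell0 c_cell; split=> //; exists c^-1%g.
(* Distinct Schubert cells are disjoint, so one point of the common cell determines the
   permutation. *)
- move=> c c'; rewrite !inE => /cell0[X cX] _ cc'.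
  have c'X : hessenberg_cell M P H c'^-1 X by rewrite -cc'.
  exact: invg_inj (schubert_cell_inj P1 cX.1 c'X.1).
- move=> X [+ [pi XE]]; rewrite {}XE => Xn; exists pi^-1%g; last by rewrite invgK.
  by apply/cell0; rewrite invgK.
move=> pi pi_perm.
rewrite -(card_free_entries (fun k j : 'I_n => directly_above Y k j) dg_homo).
rewrite -[pi in hessenberg_cell _ _ _ pi]invgK.
exact: cell_affine P1 H_hess h_hess Hh dg_homo lam_eq above_dg above_lt
  above_mono above_bottom ofM _ pi_perm.
Qed.
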